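(* If $K$ is a nonmetrizable separable compact line, then there is a countable discrete extension $L$ of $K$ satisfying $\eta(K,L)=3$.
   Context: All topological spaces are Hausdorff. A compact line is a compact space whose topology is the order topology of some linear order. A countable discrete extension of a compact space $K$ is a compact space $L\supseteq K$ (containing $K$ as a subspace) such that $L\setminus K$ is a countably infinite discrete set. $C(K)$ is the Banach space of real-valued continuous functions on $K$ with the supremum norm. For compact spaces $K\subseteq L$, an extension operator is a bounded linear operator $E:C(K)\to C(L)$ such that $(Ef)|_K=f$ for every $f\in C(K)$. $\eta(K,L)$ denotes the infimum of the norms of all extension operators $E:C(K)\to C(L)$, with $\eta(K,L)=\infty$ if there is no such (bounded) operator. *)

(* Defs.v *)
From HB Require Import structures.
From mathcomp Require Import all_boot all_order all_algebra.
From mathcomp Require Import all_classical all_reals all_analysis.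

Set Implicit Arguments.
Unset Strict Implicit.
Unset Printing Implicit Defensive.

Import Order.TTheory GRing.Theory Num.Theory.
Import numFieldNormedType.Exports.

Local Open Scope classical_set_scope.
Local Open Scope ring_scope.

(* C(X) is [continuousType X R] with the pointwise operations. *)
Section continuous_lmodule.
Context {X : topologicalType} {R : realType}.
Implicit Types (f g : continuousType X R) (a : R).

Let addf_cts f g : continuous (fun x => f x + g x).
Proof. by move=> x; apply: cvgD; exact: cts_fun. Qed.

Let oppf_cts f : continuous (fun x => - f x).
Proof. by move=> x; apply: cvgN; exact: cts_fun. Qed.

Let scalef_cts a f : continuous (fun x => a * f x).
Proof. by move=> x; apply: cvgMl_tmp; exact: cts_fun. Qed.

Let zerof_cts : continuous (fun _ : X => 0 : R).
Proof. by move=> x; exact: cvg_cst. Qed.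

Definition ctsf0 : continuousType X R := mkcts zerof_cts.
Definition ctsfD f g : continuousType X R := mkcts (@addf_cts f g).
Definition ctsfN f : continuousType X R := mkcts (@oppf_cts f).
Definition ctsfZ a f : continuousType X R := mkcts (@scalef_cts a f).

Let ctsfDA : associative ctsfD.
Proof. by move=> f g h; apply/continuousEP => x; exact: addrA. Qed.

Let ctsfDC : commutative ctsfD.
Proof. by move=> f g; apply/continuousEP => x; exact: addrC. Qed.

Let ctsf0D : left_id ctsf0 ctsfD.
Proof. by move=> f; apply/continuousEP => x; exact: add0r. Qed.

Let ctsfND : left_inverse ctsf0 ctsfN ctsfD.
Proof. by move=> f; apply/continuousEP => x; exact: addNr. Qed.

HB.instance Definition _ := GRing.isZmodule.Build (continuousType X R)
  ctsfDA ctsfDC ctsf0D ctsfND.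

Let ctsfZA a b f : ctsfZ a (ctsfZ b f) = ctsfZ (a * b) f.
Proof. by apply/continuousEP => x; exact: mulrA. Qed.

Let ctsf1Z : left_id 1 ctsfZ.
Proof. by move=> f; apply/continuousEP => x; exact: mul1r. Qed.

Let ctsfZDr : right_distributive ctsfZ +%R.
Proof. by move=> a f g; apply/continuousEP => x; exact: mulrDr. Qed.

Let ctsfZDl f : {morph ctsfZ^~ f : a b / a + b}.
Proof. by move=> a b; apply/continuousEP => x; exact: mulrDl. Qed.

HB.instance Definition _ := GRing.Zmodule_isLmodule.Build R
  (continuousType X R) ctsfZA ctsf1Z ctsfZDr ctsfZDl.

End continuous_lmodule.

(* The supremum is meaningful because [sup_norm] is only used on compact
   spaces; on the empty space it is [sup set0 = 0]. *)
Definition sup_norm (R : realType) (X : topologicalType)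
    (f : continuousType X R) : R :=
  sup [set `|f x| | x in [set: X]].

Section operators.
Context {R : realType} {X Y : topologicalType}.
Implicit Type E : {linear continuousType X R -> continuousType Y R}.

Definition bounded_operator E :=
  exists M : R, forall f, sup_norm (E f) <= M * sup_norm f.

(* Only meaningful when [E] is bounded: the real supremum of an unbounded set
   is 0 by convention. *)
Definition operator_norm E : R :=
  sup [set sup_norm (E f) | f in [set f | sup_norm f <= 1]].

End operators.

Definition topological_embedding (X Y : topologicalType) (i : X -> Y) :=
  injective i /\ @open X = [set i @^-1` B | B in @open Y].

Definition metrizable (R : realType) (X : topologicalType) :=
  exists (M : metricType R) (i : X -> M),
    topological_embedding i /\ range i = [set: M].

Definition separable (X : topologicalType) :=
  exists2 D : set X, countable D & dense D.

(* The inclusion of [K] in [L] is represented by an embedding [i : K -> L]. *)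
Definition countable_discrete_extension (K L : topologicalType) (i : K -> L) :=
  [/\ hausdorff_space L, compact [set: L], topological_embedding i,
      (~` range i #= [set: nat])%card & isolated (~` range i) = ~` range i].

Definition extension_operator (R : realType) (K L : topologicalType)
    (i : K -> L) (E : {linear continuousType K R -> continuousType L R}) :=
  bounded_operator E /\ forall f x, E f (i x) = f x.

(* The infimum is [+oo] when there is no extension operator. *)
Definition eta (R : realType) (K L : topologicalType) (i : K -> L) : \bar R :=
  ereal_inf [set (operator_norm E)%:E | E in @extension_operator R K L i].

(* Main.v *)
From HB Require Import structures.
Require Import Defs.
From mathcomp Require Import all_boot all_order all_algebra.
From mathcomp Require Import all_classical all_reals all_analysis.
From mathcomp Require Import ring lra.

(* Call a in K a jump if a has an immediate successor a'. If only countably many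
   points were jumps, countably many Urysohn functions would separate the points
   of K; so there are uncountably many jumps. Enumerate a dense set as e_0, e_1,
   ..., let p_n and q_n be the points closest to e_n from the left and from the
   right among e_0, ..., e_(n-1), min K, max K, and give L = K + N the initial
   topology of the indicators of the points of N and of the functions that extend
   f in C(K) by f(p_n) - f(e_n) + f(q_n) at n. These functions define an extension
   operator of norm at most 3. L is compact because along a free ultrafilter on N the limits
   x <= y <= z of p_n, e_n, q_n satisfy x = y or y = z: two triples of this kind
   are never close to the same x < y < z.
   Conversely let E be an extension operator, and let h_a be the indicator of
   ]-oo, a] for a jump a. Then E h_a is close to the alternating value of h_a for
   all n >= N(a), and N is constant on some infinite set of jumps. Two of its
   elements a < b are first separated by some e_n with n large, so that
   p_n <= a < e_n <= b < q_n; there E h_a, E h_b and E 1 are close to 1, 0 and 1,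
   and E (2 h_a - 2 h_b + 1) is close to 3, while 2 h_a - 2 h_b + 1 has norm 1. *)

Set Implicit Arguments.
Unset Strict Implicit.
Unset Printing Implicit Defensive.

Import Order.TTheory GRing.Theory Num.Theory.
Import numFieldNormedType.Exports.

Local Open Scope classical_set_scope.
Local Open Scope ring_scope.

(** * Metrizability of compact spaces with countably many separating functions *)

Lemma compact_hausdorff_embedding (X Y : topologicalType) (i : X -> Y) :
  compact [set: X] -> hausdorff_space Y -> continuous i -> injective i ->
  topological_embedding i.
Proof.
move=> cX hY ci inji; split => //; apply/seteqP; split => [A oA|_ [B oB <-]].
  exists (~` (i @` (~` A))).
    apply: closed_openC; apply: (compact_closed hY).
    apply: continuous_compact; first exact: continuous_subspaceT.
    by apply: subclosed_compact cX _ => //; exact: open_closedC.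
  apply/seteqP; split => [x /= nx|x Ax [y nAy /inji yx]]; last first.
    by rewrite yx in nAy.
  by apply: contrapT => nAx; apply: nx; exists x.
exact: open_comp.
Qed.

(** An alias of [X], so that the metric topology can coexist with the given one. The two hypotheses
    are parameters of the type because the metric axioms depend on them. *)
Definition sup_metric_space (R : realType) (X : topologicalType)
    (f : nat -> X -> R) (f01 : forall n x, 0 <= f n x <= 1)
    (fsep : forall x y, (forall n, f n x = f n y) -> x = y) : Type := X.

Section sup_metric.
Context (R : realType) (X : topologicalType) (f : nat -> X -> R)
  (f01 : forall n x, 0 <= f n x <= 1)
  (fsep : forall x y, (forall n, f n x = f n y) -> x = y).

Local Notation M := (sup_metric_space f01 fsep).

Definition weighted_gap (x y : X) (n : nat) : R :=
  `|f n x - f n y| / n.+1%:R.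

Definition sup_dist (x y : M) : R := sup (range (weighted_gap x y)).

Lemma weighted_gap_le x y n : weighted_gap x y n <= n.+1%:R^-1.
Proof.
rewrite /weighted_gap ler_piMl ?invr_ge0//.
have /andP[a b] := f01 n x; have /andP[c e] := f01 n y.
by rewrite ler_norml; apply/andP; split; lra.
Qed.

Lemma sup_dist_ub x y n : weighted_gap x y n <= sup_dist x y.
Proof.
apply: ub_le_sup; last by exists n.
exists 1 => _ [m _ <-]; apply: le_trans (weighted_gap_le _ _ _) _.
by rewrite invf_le1// ler1n.
Qed.

Lemma sup_dist_le x y e : (forall n, weighted_gap x y n <= e) ->
  sup_dist x y <= e.
Proof.
move=> h; apply: ge_sup; first by exists (weighted_gap x y 0); exists 0%N.
by move=> _ [n _ <-].
Qed.

Let sup_distxx x : sup_dist x x = 0.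
Proof.
apply/eqP; rewrite eq_le; apply/andP; split.
  by apply: sup_dist_le => n; rewrite /weighted_gap subrr normr0 mul0r.
by apply: le_trans (sup_dist_ub x x 0); rewrite /weighted_gap divr_ge0.
Qed.

Let sup_dist_eq0 x y : sup_dist x y = 0 -> x = y.
Proof.
move=> xy0; apply: fsep => n; apply/eqP; rewrite -subr_eq0 -normr_le0.
have := sup_dist_ub x y n; rewrite xy0 /weighted_gap.
by rewrite pmulr_lle0// invr_gt0.
Qed.

Let sup_distC x y : sup_dist x y = sup_dist y x.
Proof.
rewrite /sup_dist; suff -> : weighted_gap x y = weighted_gap y x by [].
by apply/funext => n; rewrite /weighted_gap distrC.
Qed.

Let sup_dist_triangle y x z : sup_dist x z <= sup_dist x y + sup_dist y z.
Proof.
apply: sup_dist_le => n.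
apply: le_trans (lerD (sup_dist_ub x y n) (sup_dist_ub y z n)).
by rewrite /weighted_gap -mulrDl ler_pM2r ?invr_gt0// ler_distD.
Qed.

HB.instance Definition _ := Choice.on M.
HB.instance Definition _ := isMetric.Build R M
  sup_distxx sup_dist_eq0 sup_distC sup_dist_triangle.

(** The gaps of large index are small uniformly in [y], so only finitely many of the [f n] have to
    be controlled near [x]. *)
Lemma id_sup_metric_continuous : (forall n, continuous (f n)) ->
  continuous (id : X -> M).
Proof.
move=> fc x.
apply: (proj2 (@metricType_numDomainType.cvgrPdist_lt _ M _ (nbhs x) _ id x)).
move=> e e0.
have e2 : 0 < e / 2 by rewrite divr_gt0.
have [N _ hN] := near_infty_natSinv_lt (PosNum e2).
have : \forall y \near x, forall n : 'I_N, weighted_gap x y n <= e / 2.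
  apply: filter_forall => n.
  have := fc n x => /cvgrPdist_le/(_ _ e2); apply: filterS => y h.
  rewrite /weighted_gap (le_trans _ h)// ler_piMr//.
  by rewrite invf_le1// ler1n.
apply: filterS => y h; apply: (@le_lt_trans _ _ (e / 2)); last lra.
apply: sup_dist_le => n; have [nN|Nn] := ltnP n N.
  exact: (h (Ordinal nN)).
exact: le_trans (weighted_gap_le _ _ _) (ltW (hN n Nn)).
Qed.

End sup_metric.

(** The identity onto the metric alias is a continuous injection of a compact space into a Hausdorff
    space, hence an embedding. *)
Lemma separating_sequence_metrizable (R : realType) (X : topologicalType)
    (f : nat -> X -> R) : compact [set: X] -> (forall n, continuous (f n)) ->
  (forall n x, 0 <= f n x <= 1) ->
  (forall x y, (forall n, f n x = f n y) -> x = y) -> metrizable R X.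
Proof.
move=> cX fc f01 fsep.
pose M : metricType R := sup_metric_space f01 fsep.
exists M, (id : X -> M).
split; last by rewrite image_id.
apply: compact_hausdorff_embedding => //.
  exact: metric_hausdorff.
exact: id_sup_metric_continuous.
Qed.

Lemma separating_family_metrizable (R : realType) (X : topologicalType)
    (T : Type) (I : set T) (f : T -> X -> R) : compact [set: X] ->
  countable I -> (forall i, I i -> continuous (f i)) ->
  (forall i x, I i -> 0 <= f i x <= 1) ->
  (forall x y, (forall i, I i -> f i x = f i y) -> x = y) -> metrizable R X.
Proof.
move=> cX /pfcard_geP[I0|[e]] fc f01 fsep.
  apply: (@separating_sequence_metrizable R X (fun _ _ => 0)) => //.
  - by move=> _ x; exact: cvg_cst.
  - by move=> _ _; rewrite lexx ler01.
  - by move=> x y _; apply: fsep => i; rewrite I0.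
have Ie n : I (e n) by exact: funS.
apply: (@separating_sequence_metrizable R X (f \o e)) => //.
- by move=> n; exact: fc.
- by move=> n x; exact: f01.
- by move=> x y xy; apply: fsep => i /(@surj _ _ _ _ e)[n _ <-]; exact: xy.
Qed.

(** * Jumps of a compact line *)

Lemma countableU (T : Type) (A B : set T) :
  countable A -> countable B -> countable (A `|` B).
Proof.
move=> cA cB; rewrite -bigcup2E; apply: bigcup_countable => //.
by move=> [|[|n]] _ //=; exact: countable0.
Qed.

Section jumps.
Context {d : Order.disp_t} {K : orderTopologicalType d}.
Implicit Types a b x y : K.
Local Open Scope order_scope.

Definition adjacent a b := a < b /\ forall x, ~~ (a < x < b).

Definition jumps : set K := [set a | exists b, adjacent a b].

Lemma adjacent_or_mem_dense (D : set K) a b : dense D -> a < b ->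
  adjacent a b \/ exists2 x, D x & a < x < b.
Proof.
move=> dD ab; have [[x axb]|nex] := pselect (exists x, a < x < b).
  right; have [] := dD `]a, b[%classic; first by exists x; rewrite /= in_itv.
    exact: itv_open.
  by move=> y [yab Dy]; exists y => //; move: yab; rewrite /= in_itv.
by left; split=> // x; apply/negP => axb; apply: nex; exists x.
Qed.

(** If [b'] is the immediate successor of [b], then the half-open interval ]a, b] is the open
    interval ]a, b'[. *)
Lemma dense_mem_oc (D : set K) a b : dense D -> jumps b -> a < b ->
  exists2 x, D x & a < x <= b.
Proof.
move=> dD [b' [bb' nb]] ab.
have [] := dD `]a, b'[%classic; first by exists b; rewrite /= in_itv /= ab bb'.
  exact: itv_open.
move=> x [+ Dx]; rewrite /= in_itv /= => /andP[ax xb']; exists x => //.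
by rewrite ax leNgt; apply/negP => bx; move: (nb x); rewrite bx xb'.
Qed.

Definition ray_urysohn (R : realType) a b : K -> R :=
  Urysohn `]-oo, a] `[b, +oo[.

Lemma ray_separator (R : realType) a b : compact [set: K] -> a < b ->
  uniform_separator (`]-oo, a]%classic : set K) `[b, +oo[%classic.
Proof.
move=> cK ab; have /(normal_separatorP (R := R)) : normal_space K.
  exact: compact_normal order_hausdorff cK.
apply.
- exact: lray_closed.
- exact: rray_closed.
- apply/seteqP; split => // x [] /=; rewrite !in_itv /= andbT => xa bx.
  by have := lt_le_trans ab (le_trans bx xa); rewrite ltxx.
Qed.

Lemma ray_urysohn0 (R : realType) a b x : compact [set: K] -> a < b ->
  x <= a -> ray_urysohn R a b x = 0%R.
Proof.
move=> cK /(ray_separator R cK) ab xa; apply: (Urysohn_sub0 ab).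
by exists x => //=; rewrite in_itv.
Qed.

Lemma ray_urysohn1 (R : realType) a b x : compact [set: K] -> a < b ->
  b <= x -> ray_urysohn R a b x = 1%R.
Proof.
move=> cK /(ray_separator R cK) ab bx; apply: (Urysohn_sub1 ab).
by exists x => //=; rewrite in_itv /= andbT.
Qed.

Lemma countable_jumps_metrizable (R : realType) : compact [set: K] ->
  separable K -> countable jumps -> metrizable R K.
Proof.
move=> cK [D cD dD] cJ.
(* The default value [a] occurs only outside [jumps], where [succ] is never applied. *)
pose succ a := xget a (adjacent a).
have succP a : jumps a -> adjacent a (succ a).
  by move=> [b ab]; exact: (xgetI a ab).
pose Q := D `|` jumps `|` (succ @` jumps).
have cQ : countable Q.
  rewrite /Q; repeat apply: countableU => //.
  by apply: sub_countable cJ; exact: card_image_le.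
pose I := [set pq : K * K | Q pq.1 /\ Q pq.2 /\ pq.1 < pq.2].
pose f (pq : K * K) := ray_urysohn R pq.1 pq.2.
(* If [x] is a jump with successor [y], that pair serves. Otherwise some [c] of [D] lies between
   them, and either [c] has successor [y] or a second point of [D] lies between [c] and [y]. *)
have between x y : x < y -> exists p q, [/\ I (p, q), x <= p & q <= y].
  move=> xy; have [adj|[c Dc /andP[xc cy]]] := adjacent_or_mem_dense dD xy.
    have Jx : jumps x by exists y.
    exists x, (succ x); split => //.
      split; first by left; right.
      by split; [right; exists x | have [] := succP _ Jx].
    rewrite leNgt; apply/negP => ys; have [_ /(_ y)] := succP _ Jx.
    by rewrite xy ys.
  have [adj|[e De /andP[ce ey]]] := adjacent_or_mem_dense dD cy.
    have Jc : jumps c by exists y.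
    exists c, (succ c); split; [|exact: ltW|].
      split; first by left; right.
      by split; [right; exists c | have [] := succP _ Jc].
    rewrite leNgt; apply/negP => ys; have [_ /(_ y)] := succP _ Jc.
    by rewrite cy ys.
  exists c, e; split; [|exact: ltW|exact: ltW].
  by split; [left; left|split=> //; left; left].
have fsep x y : x < y -> ~ (forall i, I i -> f i x = f i y).
  move=> /between[p [q [Ipq xp qy]]] /(_ _ Ipq).
  have [_ [_ /= pq]] := Ipq.
  rewrite /f ray_urysohn0// ray_urysohn1// => /eqP.
  by rewrite eq_sym oner_eq0.
apply: (@separating_family_metrizable R K _ I f) => //.
- apply: sub_countable (countableX cQ cQ).
  by apply: subset_card_le => pq [? []].
- by move=> i _; exact: Urysohn_continuous.
- move=> i x _; have := @Urysohn_range K R `]-oo, i.1] `[i.2, +oo[.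
  by move=> /(_ (f i x)) /=; rewrite in_itv /=; apply; exists x.
- move=> x y xy; have [] // := ltgtP x y => [/fsep//|/fsep nyx].
  by exfalso; apply: nyx => i Ii; rewrite xy.
Qed.

Definition lray_ind {R : realType} a (x : K) : R := if x <= a then 1 else 0.

(** At a jump with successor [b], the closed ray up to [a] equals the open ray below [b], so the
    indicator is locally constant. *)
Lemma lray_ind_continuous (R : realType) a :
  jumps a -> continuous (@lray_ind R a).
Proof.
move=> [b [ab nab]] x; apply: (@near_cst_continuous _ _ (lray_ind a x)).
rewrite /lray_ind.
have [xa|ax] := leP x a.
  have : nbhs x `]-oo, b[%classic.
    apply: open_nbhs_nbhs; split; first exact: lray_open.
    by rewrite /= in_itv /= (le_lt_trans xa).
  apply: filterS => y; rewrite /= in_itv /= => yb.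
  by case: leP => // ay; have := nab y; rewrite ay yb.
have : nbhs x `]a, +oo[%classic.
  apply: open_nbhs_nbhs; split; first exact: rray_open.
  by rewrite /= in_itv /= andbT.
by apply: filterS => y; rewrite /= in_itv /= andbT => ay; rewrite leNgt ay.
Qed.

End jumps.

(** * Neighbours within a dense sequence *)

Section triples.
Context {d : Order.disp_t} {K : orderTopologicalType d}.
Implicit Types a b x y : K.
Local Open Scope order_scope.

(** The closed rays ]-oo, x] generate a proper filter, and a cluster point of it lies in all of
    them. *)
Lemma compact_line_min : compact [set: K] -> [set: K] !=set0 ->
  exists m : K, forall x, m <= x.
Proof.
move=> cK [x0 _].
pose F := filter_from [set: K] (fun x => `]-oo, x]%classic : set K).
have FF : ProperFilter F.
  apply: filter_from_proper; last by move=> x _; exists x; rewrite /= in_itv /=.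
  apply: filter_from_filter; first by exists x0.
  move=> x y _ _; exists (Order.min x y) => // z.
  by rewrite /= !in_itv /= le_min => /andP[].
have [m [_ mF]] := cK F FF filterT.
exists m => x; have : closure `]-oo, x]%classic m.
  by move=> B Bm; apply: mF => //; exists x.
by move/(@lray_closed d K x); rewrite /= in_itv.
Qed.

Lemma compact_line_max : compact [set: K] -> [set: K] !=set0 ->
  exists m : K, forall x, x <= m.
Proof.
move=> cK [x0 _].
pose F := filter_from [set: K] (fun x => `[x, +oo[%classic : set K).
have FF : ProperFilter F.
  apply: filter_from_proper; last first.
    by move=> x _; exists x; rewrite /= in_itv /= andbT.
  apply: filter_from_filter; first by exists x0.
  move=> x y _ _; exists (Order.max x y) => // z.
  by rewrite /= !in_itv /= !andbT ge_max => /andP[].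
have [m [_ mF]] := cK F FF filterT.
exists m => x; have : closure `[x, +oo[%classic m.
  by move=> B Bm; apply: mF => //; exists x.
by move/(@rray_closed d K x); rewrite /= in_itv /= andbT.
Qed.

(** The value [m], later the minimum of [K], serves when no earlier term lies below [e n]. If [e n]
    repeats an earlier term, its neighbor is [e n] itself. *)
Definition left_neighbor (m : K) (e : nat -> K) (n : nat) : K :=
  \big[Order.max/m]_(i < n | e i <= e n) e i.

Definition right_neighbor (m : K) (e : nat -> K) (n : nat) : K :=
  \big[Order.min/m]_(i < n | e n <= e i) e i.

(** Pigeonhole: there are only finitely many patterns of comparisons with the first [N] terms. *)
Lemma same_cut_pair (e : nat -> K) (A : set K) (N : nat) : ~ finite_set A ->
  exists a b, [/\ A a, A b, a < b & forall i, (i < N)%N -> ~~ (a < e i <= b)].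
Proof.
move=> Afin; pose c a := [ffun i : 'I_N => a < e i].
have : ~ {in A &, injective c}.
  move=> /inj_card_eq cA; apply: Afin; rewrite -(eq_finite_set cA).
  exact: finite_finset.
move=> /existsNP[a] /existsNP[b] /not_implyP[/set_mem Aa].
move=> /not_implyP[/set_mem Ab] /not_implyP[cab ab].
have sep x y i : c x = c y -> (i < N)%N -> ~~ (x < e i <= y).
  move=> /ffunP + iN => /(_ (Ordinal iN)); rewrite !ffunE /= => ->.
  by rewrite leNgt andbN.
have [lab|lba|//] := ltgtP a b.
- by exists a, b; split=> // i; exact: sep.
- by exists b, a; split=> // i; exact: sep.
Qed.

Lemma splitting_triples : compact [set: K] -> separable K ->
    [set: K] !=set0 ->
  exists p e q : nat -> K, [/\ forall n, p n <= e n <= q n,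
    forall m n, (m < n)%N -> e m <= p n \/ q n <= e m &
    forall A N, ~ finite_set A -> A `<=` jumps ->
      exists n a b, [/\ (N <= n)%N, A a, A b,
        p n <= a < e n & e n <= b < q n]].
Proof.
move=> cK [D /pfcard_geP cD dD] K0.
have [mn hmn] := compact_line_min cK K0.
have [mx hmx] := compact_line_max cK K0.
case: cD => [D0|[e]].
  by have [x] := dD setT K0 openT; rewrite D0 => -[].
exists (left_neighbor mn e), e, (right_neighbor mx e); split.
- move=> n; apply/andP; split; first exact: bigmax_le.
  exact: le_bigmin.
- move=> m n mn'; case: (leP (e m) (e n)) => [emn|/ltW enm]; [left|right].
    exact: (@le_bigmax_cond _ _ _ _ (Ordinal mn')).
  exact: (@bigmin_le_cond _ _ _ _ (Ordinal mn')).
- move=> A N Afin AJ.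
  have [a [b [Aa Ab ab sep]]] := same_cut_pair e N Afin.
  have exn : exists n, a < e n <= b.
    have [x /(@surj _ _ _ _ e)[n _ <-] h] := dense_mem_oc dD (AJ _ Ab) ab.
    by exists n.
  (* For the least [n] with [e n] in ]a, b], all earlier terms avoid ]a, b], so both neighbors of
     [e n] fall outside it. *)
  case: (ex_minnP exn) => n /andP[an nb] nmin; exists n, a, b; split=> //.
  + by rewrite leqNgt; apply/negP => /sep; rewrite an nb.
  + rewrite an andbT; apply: bigmax_le => // i ein; rewrite leNgt; apply/negP.
    move=> ai; have := nmin i; rewrite ai (le_trans ein nb) => /(_ isT).
    by rewrite leqNgt ltn_ord.
  + rewrite nb /=; apply: lt_bigmin.
      (* The starting value [mx] also exceeds [b], since the jump [b] has a successor. *)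
      by have [b' [bb' _]] := AJ _ Ab; exact: lt_le_trans bb' _.
    move=> i ein; rewrite ltNge; apply/negP => ib.
    have := nmin i; rewrite ib (lt_le_trans an ein) => /(_ isT).
    by rewrite leqNgt ltn_ord.
Qed.

End triples.

(** * The extension as an initial topology on [K + nat] *)

Lemma ultra_fmap (T U : Type) (f : T -> U) (F : set_system T) :
  UltraFilter F -> UltraFilter (f @ F).
Proof.
move=> FU; split; first exact: fmap_proper_filter.
move=> G GF FG; apply/seteqP; split => // A GA.
case: (in_ultra_setVsetC (f @^-1` A) FU) => // FnA.
have /filter_ex[x []//] : G (A `&` ~` A) by apply: filterI => //; exact: FG.
Qed.

(** If no point lies between [x] and [y], the open rays ]-oo, y[ and ]x, +oo[ are ]-oo, x] and [y,
    +oo[. *)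
Lemma lt_nbhs_separated (d : Order.disp_t) (K : orderTopologicalType d)
    (x y : K) : (x < y)%O ->
  exists A B, [/\ nbhs x A, nbhs y B & forall a b, A a -> B b -> (a < b)%O].
Proof.
move=> xy; have [[c /andP[xc cy]]|nc] := pselect (exists c, (x < c < y)%O).
  exists `]-oo, c[%classic, `]c, +oo[%classic; split.
  - by apply: open_nbhs_nbhs; split; [exact: lray_open|rewrite /= in_itv].
  - apply: open_nbhs_nbhs; split; first exact: rray_open.
    by rewrite /= in_itv /= andbT.
  - by move=> a b /=; rewrite !in_itv /= andbT; exact: lt_trans.
exists `]-oo, y[%classic, `]x, +oo[%classic; split.
- by apply: open_nbhs_nbhs; split; [exact: lray_open|rewrite /= in_itv].
- apply: open_nbhs_nbhs; split; first exact: rray_open.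
  by rewrite /= in_itv /= andbT.
- move=> a b /=; rewrite !in_itv /= andbT => ay xb.
  have ax : (a <= x)%O.
    by rewrite leNgt; apply/negP => xa; apply: nc; exists a; rewrite xa.
  exact: le_lt_trans xb.
Qed.

Section weak_extension.
Context (R : realType) (K : topologicalType) (p e q : nat -> K).

(** Being the identity on [K], it lets one alternating formula cover both summands: on [K] it
    collapses to [f x]. *)
Definition anchor (r : nat -> K) (l : K + nat) : K :=
  match l with inl x => x | inr n => r n end.

Definition alternating_value (f : continuousType K R) (l : K + nat) : R :=
  f (anchor p l) - f (anchor e l) + f (anchor q l).

Definition test_function (i : continuousType K R + nat) (l : K + nat) : R :=
  match i with inl f => alternating_value f l | inr n => (l == inr n)%:R end.

(** The supremum of the initial topologies is the coarsest topology that makes every test function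
    continuous. *)
Definition weak_extension : topologicalType :=
  sup_topology (fun i => Topological.on (initial_topology (test_function i))).

Local Notation L := weak_extension.

Lemma weak_extension_cvg (F : set_system L) (l : L) : Filter F ->
  (forall i, test_function i @ F --> test_function i l) -> F --> l.
Proof.
move=> FF h; apply/cvg_sup => i U [? [[B oB <-]] Bl] /filterS; apply.
by apply: h; exact: open_nbhs_nbhs.
Qed.

Lemma test_function_continuous i : continuous (test_function i : L -> R).
Proof.
move=> l; have /cvg_sup/(_ i) h : nbhs l --> l by [].
apply: cvg_trans (@initial_continuous _ _ (test_function i) l).
exact: cvg_app h.
Qed.

Lemma weak_extension_inr_nbhs n : nbhs (inr n : L) [set inr n].
Proof.
have h : nbhs (1 : R) [set r | 0 < r] by exact: lt_nbhsr.
have := @test_function_continuous (inr n) (inr n) [set r | 0 < r].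
have -> : test_function (inr n) (inr n) = 1 by rewrite /= eqxx.
move=> /(_ h).
apply: (@filterS L (nbhs (inr n : L))) => l /=; case: eqP => [->//|_].
by rewrite ltxx.
Qed.

Lemma weak_extension_inl_continuous : continuous (inl : K -> L).
Proof.
move=> x; apply: weak_extension_cvg => -[f|n] /=; last exact: cvg_cst.
apply: (@cvgD _ R^o); last exact: cts_fun.
by apply: (@cvgB _ R^o); exact: cts_fun.
Qed.

Lemma range_inlC : ~` range (inl : K -> L) = range (inr : nat -> L).
Proof.
apply/seteqP; split => [[x|n] /= h|_ [n _ <-] [x _]//]; last by exists n.
by exfalso; apply: h; exists x.
Qed.

Lemma weak_extension_discrete :
  (~` range (inl : K -> L) #= [set: nat])%card /\
  isolated (~` range (inl : K -> L)) = ~` range (inl : K -> L).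
Proof.
rewrite range_inlC; split.
  by apply: inj_card_eq => m n _ _ [].
apply/seteqP; split; first exact: isolatedS.
move=> _ [n _ <-]; split; first by apply/mem_set; exists n.
exists [set inr n]; first exact: weak_extension_inr_nbhs.
by apply/seteqP; split => [l []//|_ ->]; split=> //; exists n.
Qed.

Lemma weak_extension_hausdorff :
  (forall x y, x != y -> exists2 f : continuousType K R, True & f x != f y) ->
  hausdorff_space L.
Proof.
move=> sepK l l' ll'.
(* Points without disjoint neighborhoods have the same image under every continuous map to the
   Hausdorff space of reals. *)
have eq_test i : test_function i l = test_function i l'.
  apply: (@Rhausdorff R) => A B /test_function_continuous lA.
  move=> /test_function_continuous lB.
  by have [z []] := ll' _ _ lA lB; exists (test_function i z).
case: l l' {ll'} eq_test => [x|n] [y|m] eq_test.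
- congr inl; apply/eqP; apply: contrapT => /negP /sepK[f _ /eqP]; apply.
  by have := eq_test (inl f); rewrite /= /alternating_value /= !subrr !add0r.
- by have := eq_test (inr m) => /eqP; rewrite /= eqxx eq_sym oner_eq0.
- by have := eq_test (inr n) => /eqP; rewrite /= eqxx oner_eq0.
- have [->//|mn] := eqVneq (inr m : K + nat) (inr n).
  have := eq_test (inr n); rewrite /= eqxx (negbTE mn) => /eqP.
  by rewrite oner_eq0.
Qed.

Definition alternating_extension (f : continuousType K R) :
  continuousType L R := mkcts (test_function_continuous (i := inl f)).

Lemma alternating_extension_linear : linear alternating_extension.
Proof.
move=> a f g; apply/continuousEP => l.
change (alternating_value (a *: f + g) l =
  a * alternating_value f l + alternating_value g l).
rewrite /alternating_value.
change ((a *: f + g) (anchor p l)) with (a * f (anchor p l) + g (anchor p l)).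
change ((a *: f + g) (anchor e l)) with (a * f (anchor e l) + g (anchor e l)).
change ((a *: f + g) (anchor q l)) with (a * f (anchor q l) + g (anchor q l)).
by ring.
Qed.

HB.instance Definition _ := GRing.isLinear.Build R (continuousType K R)
  (continuousType L R) *:%R alternating_extension alternating_extension_linear.

End weak_extension.

(** * Compactness of the extension *)

Section weak_extension_line.
Context (R : realType) (d : Order.disp_t) (K : orderTopologicalType d).
Context (p e q : nat -> K).
Context (cK : compact [set: K]).
Context (peq : forall n, (p n <= e n <= q n)%O).
Context (split_once :
  forall m n, (m < n)%N -> (e m <= p n)%O \/ (q n <= e m)%O).

Local Notation L := (weak_extension R p e q).

Lemma anchor_limit_le (F : set_system (K + nat)) (r s : nat -> K) (x y : K) :
  ProperFilter F -> (forall n, (r n <= s n)%O) ->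
  anchor r @ F --> x -> anchor s @ F --> y -> (x <= y)%O.
Proof.
move=> FF rs rx sy; rewrite leNgt; apply/negP => /lt_nbhs_separated.
move=> [A [B [yA xB AB]]].
have /filter_ex[l [/= Al Bl]] : F ((anchor s @^-1` A) `&` (anchor r @^-1` B)).
  by apply: filterI; [exact: sy|exact: rx].
have := AB _ _ Al Bl; apply/negP; rewrite -leNgt.
by case: (l) => //= n; exact: rs.
Qed.

Lemma weak_extension_compact : compact [set: L].
Proof.
rewrite compact_ultra => F UF _.
have lim r : exists x : K, anchor r @ F --> x.
  have := cK; rewrite compact_ultra.
  move=> /(_ _ (ultra_fmap (anchor r) UF) filterT).
  by case=> x [_ ?]; exists x.
have [x px] := lim p; have [y ey] := lim e; have [z qz] := lim q.
suff [l Fl] : exists l : L, F --> l by exists l.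
have alt_cvg (f : continuousType K R) :
    alternating_value p e q f @ F --> f x - f y + f z.
  apply: (@cvgD _ R^o); last exact: (cvg_comp _ _ qz (@cts_fun _ _ f z)).
  apply: (@cvgB _ R^o).
    exact: (cvg_comp _ _ px (@cts_fun _ _ f x)).
  exact: (cvg_comp _ _ ey (@cts_fun _ _ f y)).
(* Either [F] is principal at some [inr n], or every indicator tends to 0 along [F]; then [F] tends
   to [inl w] once the limit [f x - f y + f z] is [f w] for all [f]. *)
have [[n Fn]|Fnat] := pselect (exists n, F [set inr n]).
  by exists (inr n) => A /nbhs_singleton An; apply: filterS Fn => _ ->.
have inr_cvg n :
    test_function p e q (inr n : continuousType K R + nat) @ F --> (0 : R).
  apply/cvgrPdist_lt => eps eps0.
  have FnC : F (~` [set inr n]).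
    by case: (in_ultra_setVsetC [set inr n] UF) => // Fn; case: Fnat; exists n.
  apply: filterS FnC => l /= /eqP/negbTE ->.
  by rewrite subrr normr0.
have inl_cvg w : (forall f : continuousType K R, f x - f y + f z = f w) ->
    F --> (inl w : L).
  move=> h; apply: weak_extension_cvg => -[f|n]; last exact: inr_cvg.
  have := alt_cvg f; rewrite h.
  by rewrite /= /alternating_value /= subrr add0r.
have xy : (x <= y)%O by apply: anchor_limit_le px ey => n; have /andP[] := peq n.
have yz : (y <= z)%O by apply: anchor_limit_le ey qz => n; have /andP[] := peq n.
move: xy; rewrite le_eqVlt => /predU1P[xy|xy].
  by exists (inl z); apply: inl_cvg => f; rewrite xy subrr add0r.
move: yz; rewrite le_eqVlt => /predU1P[yz|yz].
  by exists (inl x); apply: inl_cvg => f; rewrite yz subrK.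
have [A [B [xA yB AB]]] := lt_nbhs_separated xy.
have [B' [C [yB' zC BC]]] := lt_nbhs_separated yz.
pose S := [set l | [/\ A (anchor p l), B (anchor e l), B' (anchor e l) &
  C (anchor q l)]].
have FS : F S.
  have FA : F (anchor p @^-1` A) by exact: px.
  have FB : F (anchor e @^-1` (B `&` B')) by apply: ey; exact: filterI.
  have FC : F (anchor q @^-1` C) by exact: qz.
  by apply: filterS (filterI FA (filterI FB FC)) => l /= [? [[? ?] ?]].
(* Membership of [m] and [n] in [S] would put [e m] strictly between [p n] and [q n], against
   [split_once]. *)
have separated m n : S (inr m) -> S (inr n) -> ~ (m < n)%N.
  move=> [/= _ Bm B'm _] [/= An _ _ Cn] /split_once[|].
    by apply/negP; rewrite -ltNge; exact: AB.
  by apply/negP; rewrite -ltNge; exact: BC.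
(* Since [A] and [B] are disjoint, [S] misses [K]; so [S] is a single point [inr n], which [Fnat]
   excludes from being in [F]. *)
exfalso; have [[w|n] Sl] := filter_ex FS.
  by case: Sl => /= Aw Bw _ _; have := AB _ _ Aw Bw; rewrite ltxx.
apply: Fnat; exists n; apply: filterS FS => -[w|m] Sm.
  by case: Sm => /= Aw Bw _ _; have := AB _ _ Aw Bw; rewrite ltxx.
case: (ltngtP m n) => [mn|nm|-> //].
- by case: (separated m n).
- by case: (separated n m).
Qed.

End weak_extension_line.

(** * Norm estimates, and functions vanishing on the embedded space *)

Section norms.
Context (R : realType).

Lemma le_sup_norm (X : topologicalType) (f : continuousType X R) (x : X) :
  compact [set: X] -> `|f x| <= sup_norm f.
Proof.
move=> cX; apply: ub_le_sup; last by exists x.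
have /compact_bounded[M [_ hM]] : compact (range (f : X -> R^o)).
  apply: continuous_compact => //; apply: continuous_subspaceT => z.
  exact: cts_fun.
(* [compact_bounded] provides bounds strictly above [M] only. *)
exists (M + 1) => _ [y _ <-]; apply: hM; last by exists y.
by rewrite ltrDl.
Qed.

Lemma sup_norm_le (X : topologicalType) (f : continuousType X R) (M : R) :
  0 <= M -> (forall x, `|f x| <= M) -> sup_norm f <= M.
Proof.
move=> M0 fM; have [/set0P[x _]|/negPn/eqP X0] := boolP ([set: X] != set0).
  apply: ge_sup; first by exists `|f x|; exists x.
  by move=> _ [y _ <-].
by rewrite /sup_norm X0 image_set0 sup0.
Qed.

Lemma sup_norm_ge0 (X : topologicalType) (f : continuousType X R) :
  0 <= sup_norm f.
Proof.
(* The supremum of an empty or unbounded set is 0 by convention. *)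
have [[[_ [x _ _]] ub]|/sup_out] := pselect (has_sup [set `|f x| | x in setT]).
  by apply: (le_trans (normr_ge0 (f x))); apply: ub_le_sup => //; exists x.
by rewrite /sup_norm => h; rewrite h.
Qed.

Lemma le_operator_norm (X Y : topologicalType)
    (E : {linear continuousType X R -> continuousType Y R})
    (f : continuousType X R) (y : Y) :
  compact [set: Y] -> bounded_operator E -> sup_norm f <= 1 ->
  `|E f y| <= operator_norm E.
Proof.
move=> cY [M EM] f1; apply: le_trans (le_sup_norm _ _ cY) _.
apply: ub_le_sup; last by exists f.
(* The absolute value guards against a negative [M]. *)
exists `|M| => _ [g /= g1 <-]; apply: le_trans (EM g) _.
have g0 := sup_norm_ge0 g.
apply: (@le_trans _ _ (`|M| * sup_norm g)).
  by rewrite ler_wpM2r ?ler_norm.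
by rewrite ler_piMr.
Qed.

Lemma operator_norm_le (X Y : topologicalType)
    (E : {linear continuousType X R -> continuousType Y R}) (M : R) :
  (forall f, sup_norm f <= 1 -> sup_norm (E f) <= M) -> operator_norm E <= M.
Proof.
move=> EM; apply: ge_sup; last by move=> _ [f /= f1 <-]; exact: EM.
exists (sup_norm (E 0)); exists 0 => //=.
by apply: sup_norm_le => // x; rewrite /= normr0.
Qed.

End norms.

(** Otherwise the bad points [j n] have a cluster point as [n] grows. It is not in the range of [i],
    near which [g] is small, nor some [j n], which is isolated and missed by later indices. *)
Lemma near_infty_small (R : realType) (K L : topologicalType) (i : K -> L)
    (j : nat -> L) (g : L -> R) (eps : R) :
  compact [set: L] -> (forall l, range i l \/ range j l) ->
  (forall n, nbhs (j n) [set j n]) -> continuous g ->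
  (forall x, g (i x) = 0) -> 0 < eps -> injective j ->
  exists N, forall n, (N <= n)%N -> `|g (j n)| < eps.
Proof.
move=> cL ij jopen gc g0 eps0 injj; apply: contrapT => /forallNP bad.
pose A := [set l | `|g l| < eps].
have {}bad N : exists2 n, (N <= n)%N & ~ A (j n).
  have /existsNP[n /not_implyP[Nn bn]] := bad N.
  by exists n.
pose F := filter_from [set: nat]
  (fun N => [set j n | n in [set n | (N <= n)%N /\ ~ A (j n)]]).
have FF : ProperFilter F.
  apply: filter_from_proper; last first.
    by move=> N _; have [n Nn nA] := bad N; exists (j n); exists n.
  apply: filter_from_filter; first by exists 0%N.
  move=> M N _ _; exists (maxn M N) => // _ [n [/= + nA] <-].
  by rewrite geq_max => /andP[Mn Nn]; split; exists n.
have [l [_ lF]] := cL F FF filterT.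
have [[x _ xl]|[n _ nl]] := ij l.
  have lA : nbhs l A.
    have /cvgrPdist_lt/(_ _ eps0) := gc l; rewrite -xl g0.
    by apply: filterS => z; rewrite sub0r normrN.
  have [z [[n [_ nA] <-]]] : [set j n | n in [set n | (0 <= n)%N /\ ~ A (j n)]]
      `&` A !=set0 by apply: lF => //; exists 0%N.
  by [].
have [z [[m [/= nm _] <-]]] :
    [set j m | m in [set m | (n < m)%N /\ ~ A (j m)]] `&` [set j n] !=set0.
  by apply: lF; [exists n.+1|rewrite -nl; exact: jopen].
by move=> /= /injj mn; rewrite mn ltnn in nm.
Qed.

Lemma alternating_extension_bound (R : realType) (K : topologicalType)
    (p e q : nat -> K) (f : continuousType K R) :
  compact [set: K] ->
  sup_norm (alternating_extension p e q f) <= 3 * sup_norm f.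
Proof.
move=> cK; apply: sup_norm_le => [|l].
  by rewrite mulr_ge0// sup_norm_ge0.
have h r : `|f (anchor r l)| <= sup_norm f by exact: le_sup_norm.
change (`|alternating_value p e q f l| <= 3 * sup_norm f).
move: (h p) (h e) (h q); rewrite !ler_norml /alternating_value.
by move=> /andP[? ?] /andP[? ?] /andP[? ?]; apply/andP; split; lra.
Qed.

(** * The lower bound for the norm of an extension operator *)

Section lower_bound.
Context (R : realType) (d : Order.disp_t) (K : orderTopologicalType d).
Context (p e q : nat -> K).
Context (cL : compact [set: weak_extension R p e q]).
Context (split_cofinally : forall (A : set K) N,
  ~ finite_set A -> A `<=` jumps -> exists n a b,
    [/\ (N <= n)%N, A a, A b, (p n <= a < e n)%O & (e n <= b < q n)%O]).
Context (uncountable_jumps : ~ countable (@jumps d K)).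

Local Notation L := (weak_extension R p e q).

Context (E : {linear continuousType K R -> continuousType L R}).
Context (extE : extension_operator (inl : K -> L) E).

(** Both functions restrict to [f] on [K], so their difference is continuous on [L] and vanishes on
    [K]. *)
Lemma extension_asymptotic (f : continuousType K R) (eps : R) : 0 < eps ->
  exists N, forall n, (N <= n)%N ->
    `|E f (inr n) - alternating_value p e q f (inr n)| < eps.
Proof.
move=> eps0; pose g (l : L) := E f l - alternating_value p e q f l.
have gc : continuous g.
  move=> l; apply: (@cvgB _ R^o L (nbhs l) _ (E f)).
    exact: (@cts_fun _ _ (E f) l).
  exact: (@test_function_continuous R K p e q (inl f)).
apply: (@near_infty_small R K L inl inr g) => //.
- by move=> [x|n]; [left; exists x|right; exists n].
- exact: weak_extension_inr_nbhs.
- by move=> x; rewrite /g extE.2 /alternating_value /= subrr add0r subrr.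
- by move=> m n [].
Qed.

Definition lray_cts (a : K) (Ja : jumps a) : continuousType K R :=
  mkcts (lray_ind_continuous (R := R) Ja).

Definition one_cts : continuousType K R := mkcts (@cst_continuous K R 1).

Lemma operator_norm_ge3 : 3 <= operator_norm E.
Proof.
apply/ler_addgt0Pr => eps eps0.
(* The coefficients 2, -2 and 1 of the test function amplify the three errors by 5 in total. *)
pose dlt := eps / 5; have dlt0 : 0 < dlt by rewrite divr_gt0.
pose J N := [set a | exists Ja : jumps a, forall n, (N <= n)%N ->
  `|E (lray_cts Ja) (inr n) -
    alternating_value p e q (lray_cts Ja) (inr n)| < dlt].
(* The sets [J N] cover the jumps; were all of them finite, the jumps would be countable. *)
have [N JN] : exists N, ~ finite_set (J N).
  apply: contrapT => /forallNP finJ; apply: uncountable_jumps.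
  apply: (@sub_countable _ _ _ (\bigcup_N J N)).
    apply: subset_card_le => a Ja.
    have [N hN] := extension_asymptotic (lray_cts Ja) dlt0.
    by exists N => //; exists Ja.
  apply: bigcup_countable => // N _; apply: finite_set_countable.
  exact: contrapT (finJ N).
have [N1 hN1] := extension_asymptotic one_cts dlt0.
have [|n [a [b [nN [Ja ha] [Jb hb] /andP[pa ae] /andP[eb bq]]]]] :=
  split_cofinally (maxn N N1) JN; first by move=> a [].
move: nN; rewrite geq_max => /andP[Nn N1n].
have {}ha := ha n Nn; have {}hb := hb n Nn; have {hN1} h1 := hN1 n N1n.
have ab : (a < b)%O := lt_le_trans ae eb.
(* It equals -1 on ]a, b] and 1 elsewhere; as only [e n] of the triple lies in ]a, b], its
   alternating value at [n] is 1 + 1 + 1. *)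
pose f : continuousType K R := 2 *: (lray_cts Ja - lray_cts Jb) + one_cts.
have f1 : sup_norm f <= 1.
  apply: sup_norm_le => // x.
  change (`|2 * (lray_ind a x - lray_ind b x) + 1| <= 1 :> R).
  rewrite /lray_ind.
  have [xa|ax] := leP x a.
    by rewrite (le_trans xa (ltW ab)) subrr mulr0 add0r normr1.
  by case: (leP x b) => _; rewrite ler_norml; apply/andP; split; lra.
have Ef : E f (inr n : L) = 2 * (E (lray_cts Ja) (inr n : L) -
    E (lray_cts Jb) (inr n : L)) + E one_cts (inr n : L).
  by rewrite /f linearP linearB.
have a1 : alternating_value p e q (lray_cts Ja) (inr n) = 1.
  change (lray_ind a (p n) - lray_ind a (e n) + lray_ind a (q n) = 1 :> R).
  rewrite /lray_ind pa !leNgt ae /= (lt_trans ab bq).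
  by rewrite subr0 addr0.
have b0 : alternating_value p e q (lray_cts Jb) (inr n) = 0.
  change (lray_ind b (p n) - lray_ind b (e n) + lray_ind b (q n) = 0 :> R).
  by rewrite /lray_ind eb (le_trans pa (ltW ab)) leNgt bq /= subrr addr0.
have one1 : alternating_value p e q one_cts (inr n) = 1.
  change (1 - 1 + 1 = 1 :> R); by rewrite subrr add0r.
have := le_operator_norm (inr n : L) cL extE.1 f1; rewrite Ef.
move: ha hb h1; rewrite a1 b0 one1 subr0 /dlt !ltr_norml ler_norml.
by move=> /andP[? ?] /andP[? ?] /andP[? ?] /andP[? ?]; lra.
Qed.

End lower_bound.

(* A compact line is an order topological space that is compact; it is
   automatically Hausdorff. *)
Theorem theorem5p7 (R : realType) (d : Order.disp_t)
    (K : orderTopologicalType d) (K_compact : compact [set: K])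
    (K_separable : separable K) (K_nonmetrizable : ~ metrizable R K) :
  exists (L : topologicalType) (i : K -> L),
    countable_discrete_extension i /\ eta R i = 3%:E.
Proof.
have uncJ : ~ countable (@jumps d K).
  by move=> cJ; apply: K_nonmetrizable; exact: countable_jumps_metrizable.
have K0 : [set: K] !=set0.
  (* An empty [K] would have no jumps. *)
  apply/set0P/negP => /eqP K0; apply: uncJ.
  by have -> : @jumps d K = set0; [rewrite -subset0 -K0|exact: countable0].
have [p [e [q [peq once cofinal]]]] :=
  splitting_triples K_compact K_separable K0.
pose L := weak_extension R p e q; pose i : K -> L := inl.
have cL : compact [set: L] by exact: weak_extension_compact.
have hL : hausdorff_space L.
  apply: weak_extension_hausdorff => x y; wlog xy : x y / (x < y)%O.
    move=> h; rewrite neq_lt => /orP[xy|yx].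
      by apply: (h x y) => //; rewrite lt_eqF.
    have [|f _ fyx] := h y x yx; first by rewrite lt_eqF.
    by exists f => //; rewrite eq_sym.
  pose f := @Urysohn_continuous K R `]-oo, x]%classic `[y, +oo[%classic.
  exists (mkcts f) => //.
  change (ray_urysohn R x y x != ray_urysohn R x y y).
  by rewrite ray_urysohn0// ray_urysohn1// eq_sym oner_eq0.
have [cardL discL] := weak_extension_discrete R p e q.
exists L, i; split.
  split=> //; apply: compact_hausdorff_embedding => //.
    exact: weak_extension_inl_continuous.
  by move=> x y [].
apply/eqP; rewrite eq_le; apply/andP; split; last first.
  apply: le_ereal_inf_tmp => _ [E extE <-]; rewrite lee_fin.
  exact: operator_norm_ge3.
have bound f := alternating_extension_bound p e q f K_compact.
(* The upper bound is witnessed by the alternating extension, whose values are signed sums of three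
   values of [f]. *)
apply: (@le_trans _ _ (operator_norm (alternating_extension p e q))%:E).
  apply: ereal_inf_lbound; exists (alternating_extension p e q) => //.
  split; first by exists 3%R => f; exact: bound.
  by move=> f x; change (f x - f x + f x = f x)%R; rewrite subrr add0r.
rewrite lee_fin; apply: operator_norm_le => f f1.
apply: (@le_trans _ _ (3 * sup_norm f)%R); first exact: bound.
by rewrite ger_pMr.
Qed.
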